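(* Let $n\ge1$ and $f:\{-1,1\}^n\to[-1,1]$, and let $\rho=\mathrm{dist}_{L_2}(f,\mathcal{A})$. Then \[ \mathrm{dist}_{L_2}(f,\mathcal{A}_{[-1,1]})\le\frac{18}{\sqrt{\ln(1/\rho)}}. \]
   Context: The cube $\{-1,1\}^n$ is equipped with the uniform probability measure, and $L_2$ distances are taken with respect to it: $\mathrm{dist}_{L_2}(f,\mathcal{B})=\inf_{g\in\mathcal{B}}(\mathbb{E}|f-g|^2)^{1/2}$. A function $g:\{-1,1\}^n\to\mathbb{R}$ is called affine if $g(x)=a_0+\sum_{i=1}^n a_ix_i$ for some $a_0,\dots,a_n\in\mathbb{R}$; $\mathcal{A}$ denotes the set of all affine functions, and $\mathcal{A}_{[-1,1]}\subset\mathcal{A}$ the set of all affine functions taking values in $[-1,1]$ (equivalently, those with $\sum_{i=0}^n|a_i|\le1$). *)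

(* Defs.v *)
From mathcomp Require Import all_boot all_order all_algebra.
From mathcomp Require Import classical_sets reals constructive_ereal ereal exp.

Set Implicit Arguments.
Unset Strict Implicit.
Unset Printing Implicit Defensive.

Import Order.TTheory GRing.Theory Num.Theory.

Local Open Scope classical_set_scope.
Local Open Scope ring_scope.

(* Points of {-1,1}^n are encoded by their sign bits: the i-th coordinate of x
   is (-1)^(x i), so that false stands for 1 and true for -1. *)
Definition cube (n : nat) : finType := {ffun 'I_n -> bool}.

Definition coord (R : realType) (n : nat) (x : cube n) (i : 'I_n) : R :=
  (-1) ^+ x i.

Definition expect (R : realType) (n : nat) (h : cube n -> R) : R :=
  #|cube n|%:R^-1 * \sum_(x : cube n) h x.

Definition L2norm (R : realType) (n : nat) (h : cube n -> R) : R :=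
  Num.sqrt (expect (fun x => `|h x| ^+ 2)).

(* The infimum is the real-valued one, which is the intended value only for
   nonempty B; both sets of affine functions below contain 0. *)
Definition distL2 (R : realType) (n : nat) (f : cube n -> R)
    (B : set (cube n -> R)) : R :=
  inf [set L2norm (fun x => f x - g x) | g in B].

Definition affine (R : realType) (n : nat) : set (cube n -> R) :=
  [set g | exists (a0 : R) (a : 'I_n -> R),
     forall x, g x = a0 + \sum_(i < n) a i * coord R x i].

Definition affine_bounded (R : realType) (n : nat) : set (cube n -> R) :=
  [set g | affine g /\ forall x, -1 <= g x <= 1].

(* Main.v *)
(* Let g = a0 + sum a_i x_i be the orthogonal projection of f on the affine
   functions, L = ln (1 / rho) and M = 1 + sqrt rho. Testing g against Riesz
   products prod (1 + eta_i x_i), whose second moment is prod (1 + eta_i^2),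
   gives |a0| + sum |a_i| t_i <= M whenever 0 <= t_i <= 1 and sum t_i^2 <= L.
   With t_i = min (|a_i| / tau, 1) and tau = 2 M / L this shows that the soft
   thresholding b_i of a_i at level tau satisfies |a0| + sum |b_i| <= M and
   sum (a_i - b_i)^2 <= tau M = O(1 / L); then (a0 + sum b_i x_i) / M takes
   values in [-1, 1] and is close enough to f. *)
Require Import Defs.
From mathcomp Require Import all_boot all_order all_algebra.
From mathcomp Require Import classical_sets reals constructive_ereal ereal exp.
From mathcomp Require Import sequences ring lra.

Set Implicit Arguments.
Unset Strict Implicit.
Unset Printing Implicit Defensive.

Import Order.TTheory GRing.Theory Num.Theory.
(* MathComp's [vector.coord] would otherwise shadow [coord]. *)
Import Defs.

Local Open Scope ring_scope.

Section Expectation.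
Variables (R : realType) (n : nat).
Implicit Types (h u v : cube n -> R) (c : R).

(** * Expectation on the cube *)

Lemma eq_expect u v : u =1 v -> expect u = expect v.
Proof. by move=> uv; congr (_ * _); apply: eq_bigr. Qed.

Lemma expectD u v : expect (fun x => u x + v x) = expect u + expect v.
Proof. by rewrite /expect big_split mulrDr. Qed.

Lemma expectZ c u : expect (fun x => c * u x) = c * expect u.
Proof. by rewrite /expect -mulr_sumr mulrCA. Qed.

Lemma expect_sum (I : finType) (u : I -> cube n -> R) :
  expect (fun x => \sum_i u i x) = \sum_i expect (u i).
Proof. by rewrite /expect exchange_big mulr_sumr. Qed.

Lemma le_expect u v : (forall x, u x <= v x) -> expect u <= expect v.
Proof.
by move=> uv; apply: ler_wpM2l; [rewrite invr_ge0 | apply: ler_sum => x _].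
Qed.

Lemma expect_ge0 u : (forall x, 0 <= u x) -> 0 <= expect u.
Proof. by move=> u0; rewrite mulr_ge0 ?invr_ge0 ?sumr_ge0. Qed.

Lemma expect_eq0 u : (forall x, 0 <= u x) -> expect u = 0 -> forall x, u x = 0.
Proof.
move=> u0 /eqP; rewrite mulf_eq0 invr_eq0 pnatr_eq0.
rewrite card_ffun card_bool expn_eq0 /= => /eqP su0 x.
have /psumr_eq0P : forall y : cube n, true -> 0 <= u y by [].
by move/(_ su0)/(_ x); apply.
Qed.

(** Independence of the coordinates: distributivity swaps sum and product, and the mass [2^-n] gives
    one factor [1/2] per coordinate. *)
Lemma expect_prod (F : 'I_n -> bool -> R) :
  expect (fun x => \prod_i F i (x i)) = \prod_i ((F i true + F i false) / 2).
Proof.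
rewrite /expect -(bigA_distr_bigA F) card_ffun card_bool card_ord.
rewrite big_split /= prodr_const card_ord natrX exprVn mulrC; congr (_ / _).
by apply: eq_bigr => i _; rewrite big_bool.
Qed.

Lemma expect1 : expect (fun _ : cube n => 1 : R) = 1.
Proof.
rewrite /expect sumr_const mulVf // pnatr_eq0.
by rewrite card_ffun card_bool expn_eq0.
Qed.

Lemma expect_const c : expect (fun _ : cube n => c) = c.
Proof.
have -> : expect (fun _ : cube n => c) = expect (fun _ : cube n => c * 1).
  by apply: eq_expect => x; rewrite mulr1.
by rewrite expectZ expect1 mulr1.
Qed.

(** * Riesz products and orthogonality of the coordinates *)

Definition riesz (t : 'I_n -> R) (x : cube n) : R :=
  \prod_i (1 + t i * coord R x i).

Lemma expect_riesz t : expect (riesz t) = 1.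
Proof.
rewrite (expect_prod (fun i b => 1 + t i * (-1) ^+ b)) big1 // => i _.
by rewrite expr1 expr0; field.
Qed.

Lemma expect_coord_riesz t j : expect (fun x => coord R x j * riesz t x) = t j.
Proof.
(* The extra coordinate is absorbed into the [j]-th factor, so the integrand stays a product over
   coordinates. *)
pose F i (b : bool) : R := (1 + t i * (-1) ^+ b) * (if i == j then (-1) ^+ b else 1).
rewrite (@eq_expect _ (fun x => \prod_i F i (x i))) ?expect_prod.
  rewrite (bigD1 j) //= big1 => [|i /negPf ij]; rewrite /F ?ij ?eqxx expr1 expr0.
    by field.
  by field.
move=> x; rewrite big_split /= mulrC; congr (_ * _).
by rewrite -big_mkcond big_pred1_eq.
Qed.

Lemma expect_riesz_sq t :
  expect (fun x => riesz t x ^+ 2) = \prod_i (1 + t i ^+ 2).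
Proof.
rewrite (@eq_expect _ (fun x => \prod_i (1 + t i * (-1) ^+ x i) ^+ 2)).
  rewrite (expect_prod (fun i b => (1 + t i * (-1) ^+ b) ^+ 2)).
  by apply: eq_bigr => i _; rewrite expr1 expr0; field.
by move=> x; rewrite /riesz prodrXl.
Qed.

(** Together with mean 1, this makes [riesz t] a probability density, under which the coordinates
    have means [t i]. *)
Lemma riesz_ge0 t x : (forall i, `|t i| <= 1) -> 0 <= riesz t x.
Proof.
move=> t1; apply: prodr_ge0 => i _; move: (t1 i); rewrite /coord ler_norml.
by case: (x i); rewrite ?expr1 ?expr0; lra.
Qed.

Lemma expect_coord j : expect (fun x : cube n => coord R x j) = 0.
Proof.
rewrite -[RHS](expect_coord_riesz (fun=> 0) j); apply: eq_expect => x.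
by rewrite /riesz big1 ?mulr1 // => i _; rewrite mul0r addr0.
Qed.

Lemma expect_coordM i j :
  expect (fun x : cube n => coord R x i * coord R x j) = (i == j)%:R.
Proof.
(* For these indicator weights the Riesz product is [1 + coord R x j]. *)
have := expect_coord_riesz (fun k => (k == j)%:R) i.
rewrite (@eq_expect _ (fun x => coord R x i + coord R x i * coord R x j)).
  by rewrite expectD expect_coord add0r.
move=> x; rewrite /riesz (bigD1 j) //= eqxx mul1r big1 => [|k /negPf ->].
  by rewrite mulr1 mulrDr mulr1.
by rewrite mul0r addr0.
Qed.

(** * Affine functions and their coefficients *)

Definition aff (a0 : R) (a : 'I_n -> R) (x : cube n) : R :=
  a0 + \sum_i a i * coord R x i.

Lemma expect_affM a0 a u :
  expect (fun x => aff a0 a x * u x) =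
    a0 * expect u + \sum_i a i * expect (fun x => coord R x i * u x).
Proof.
rewrite (@eq_expect _
  (fun x => a0 * u x + \sum_i a i * (coord R x i * u x))).
  rewrite expectD expectZ expect_sum; congr (_ + _).
  by apply: eq_bigr => i _; rewrite expectZ.
move=> x; rewrite mulrDl mulr_suml; congr (_ + _).
by apply: eq_bigr => i _; rewrite mulrA.
Qed.

Lemma expect_aff a0 a : expect (aff a0 a) = a0.
Proof.
rewrite expectD expect_const expect_sum big1 ?addr0 // => i _.
by rewrite expectZ expect_coord mulr0.
Qed.

Lemma expect_coord_aff a0 a j : expect (fun x => coord R x j * aff a0 a x) = a j.
Proof.
rewrite (@eq_expect _ (fun x => aff a0 a x * coord R x j)); last first.
  by move=> x; rewrite mulrC.
rewrite expect_affM expect_coord mulr0 add0r (bigD1 j) //= expect_coordM eqxx.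
rewrite mulr1 big1 ?addr0 // => i /negPf ij.
by rewrite (@eq_expect _ (fun x => coord R x i * coord R x j)) // expect_coordM ij mulr0.
Qed.

Lemma expect_aff_sq a0 a :
  expect (fun x => aff a0 a x ^+ 2) = a0 ^+ 2 + \sum_i a i ^+ 2.
Proof.
rewrite (@eq_expect _ (fun x => aff a0 a x * aff a0 a x)) //.
rewrite expect_affM expect_aff; congr (_ + _).
by apply: eq_bigr => i _; rewrite expect_coord_aff.
Qed.

Lemma affB a0 a b0 b x :
  aff a0 a x - aff b0 b x = aff (a0 - b0) (fun i => a i - b i) x.
Proof.
rewrite /aff opprD addrACA -sumrB; congr (_ + _).
by apply: eq_bigr => i _; rewrite mulrBl.
Qed.

Lemma aff_norm_le a0 a x : `|aff a0 a x| <= `|a0| + \sum_i `|a i|.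
Proof.
rewrite (le_trans (ler_normD _ _)) // lerD2l (le_trans (ler_norm_sum _ _ _)) //.
by apply: ler_sum => i _; rewrite normrM /coord normr_sign mulr1.
Qed.

(** * Distance to the affine functions and its truncation to bounded ones *)

Definition mse f h : R := expect (fun x => (f x - h x) ^+ 2).

Lemma L2norm_mse f h : L2norm (fun x => f x - h x) = Num.sqrt (mse f h).
Proof.
by congr Num.sqrt; apply: eq_expect => x; rewrite real_normK ?num_real.
Qed.

Lemma mse_ge0 f h : 0 <= mse f h.
Proof. by apply: expect_ge0 => x; rewrite sqr_ge0. Qed.

Lemma distL2_le f (B : set (cube n -> R)) h :
  B h -> distL2 f B <= Num.sqrt (mse f h).
Proof.
move=> Bh; rewrite -L2norm_mse; apply: ge_inf; last by exists h.
by exists 0 => _ [k _ <-]; rewrite L2norm_mse sqrtr_ge0.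
Qed.

(** The infimum is attained at the orthogonal projection, whose coefficients are the degree 0 and 1
    Fourier coefficients of [f]. *)
Lemma distL2_affine f :
  exists a0 a, distL2 f (@affine R n) = Num.sqrt (mse f (aff a0 a)).
Proof.
pose a0 := expect f; pose a i := expect (fun x => coord R x i * f x).
exists a0, a; apply/le_anti/andP; split; first by apply: distL2_le; exists a0, a.
apply: lb_le_inf.
  by exists (L2norm (fun x => f x - aff a0 a x)); exists (aff a0 a); first by exists a0, a.
move=> _ [h [b0 [b hE]] <-]; rewrite L2norm_mse ler_wsqrtr //.
pose d0 := a0 - b0; pose d i := a i - b i.
(* Pythagoras: the cross term vanishes since the residual is orthogonal to 1 and to every
   coordinate. *)
have -> : mse f h = mse f (aff a0 a) + expect (fun x => aff d0 d x ^+ 2)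
    + 2 * expect (fun x => aff d0 d x * (f x + -1 * aff a0 a x)).
  rewrite /mse -expectZ -!expectD; apply: eq_expect => x.
  rewrite -affB hE -/(aff b0 b x).
  by ring.
have -> : expect (fun x => aff d0 d x * (f x + -1 * aff a0 a x)) = 0.
  rewrite expect_affM expectD expectZ expect_aff mulN1r subrr mulr0 add0r.
  apply: big1 => i _.
  rewrite (@eq_expect _ (fun x => coord R x i * f x + -1 * (coord R x i * aff a0 a x))).
    by rewrite expectD expectZ expect_coord_aff mulN1r subrr mulr0.
  by move=> x; ring.
by rewrite mulr0 addr0 lerDl; apply: expect_ge0 => x; rewrite sqr_ge0.
Qed.

(* The Riesz product has mean 1 and second moment at most [1 / rho], so testing
   [f - aff a0 a] against it costs at most [sqrt rho]. *)
Lemma affine_coef_bound f a0 a rho t :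
  (forall x, -1 <= f x <= 1) -> 0 < rho -> mse f (aff a0 a) = rho ^+ 2 ->
  (forall i, 0 <= t i <= 1) -> \sum_i t i ^+ 2 <= ln rho^-1 ->
  `|a0| + \sum_i `|a i| * t i <= 1 + Num.sqrt rho.
Proof.
move=> f1 rho0 mserho t01 sumt.
set s := Num.sqrt rho.
have s0 : 0 < s by rewrite sqrtr_gt0.
have s2 : s ^+ 2 = rho by rewrite sqr_sqrtr // ltW.
pose e0 : R := (-1) ^+ (a0 < 0)%R.
(* The sign of [a0] cannot enter the Riesz product, whose mean is 1, so it multiplies the whole
   integral; [eta] carries [e0] to cancel it in the linear terms. *)
pose eta i := e0 * ((-1) ^+ (a i < 0)%R * t i).
have e0E : e0 = 1 \/ e0 = -1.
  by rewrite /e0; case: (a0 < 0); rewrite ?expr0 ?expr1; [right|left].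
have e00 : e0 * e0 = 1 by case: e0E => ->; ring.
have eta2 i : eta i ^+ 2 = t i ^+ 2.
  by rewrite /eta !exprMn /e0 !sqrr_sign !mul1r.
have eta1 i : `|eta i| <= 1.
  rewrite /eta !normrM normr_sign /e0 normr_sign !mul1r.
  by case/andP: (t01 i) => ? ?; rewrite ger0_norm.
have -> : `|a0| + \sum_i `|a i| * t i =
    expect (fun x => e0 * (aff a0 a x * riesz eta x)).
  rewrite expectZ expect_affM expect_riesz mulr1 mulrDr normrEsign -/e0.
  congr (_ + _); rewrite mulr_sumr; apply: eq_bigr => i _.
  rewrite expect_coord_riesz /eta normrEsign; set e := (-1) ^+ _.
  have -> : e0 * (a i * (e0 * (e * t i))) = (e0 * e0) * (e * a i * t i) by ring.
  by rewrite e00 mul1r.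
(* Weight for Young's inequality: [k = rho^(3/2)] balances [rho^2 / k] and [k / rho], both equal to
   [s]. *)
pose k := s ^+ 3.
have k0 : 0 < k by rewrite exprn_gt0.
have kk : k^-1 * k = 1 by rewrite mulVf ?gt_eqF.
pose bnd x := riesz eta x
  + 2^-1 * (k^-1 * (f x - aff a0 a x) ^+ 2 + k * riesz eta x ^+ 2).
apply: (@le_trans _ _ (expect bnd)).
  apply: le_expect => x; rewrite /bnd.
  have w0 := riesz_ge0 x eta1; move: (f1 x) => /andP[fl fu].
  set w := riesz eta x in w0 *; set g := aff a0 a x; set u := f x.
  have h1 : e0 * (u * w) <= w.
    by case: e0E => ->; rewrite -/u in fl fu; nra.
  have h2 : e0 * ((g - u) * w) <= 2^-1 * (k^-1 * (u - g) ^+ 2 + k * w ^+ 2).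
    have : 0 <= k^-1 * (e0 * (u - g) + k * w) ^+ 2.
      by rewrite mulr_ge0 ?invr_ge0 ?sqr_ge0 // ltW.
    have -> : k^-1 * (e0 * (u - g) + k * w) ^+ 2 =
        k^-1 * ((e0 * e0) * (u - g) ^+ 2) + 2 * (k^-1 * k) * (e0 * ((u - g) * w))
        + (k^-1 * k) * (k * w ^+ 2) by ring.
    by rewrite e00 kk !mul1r mulr1; lra.
  have -> : e0 * (g * w) = e0 * (u * w) + e0 * ((g - u) * w) by ring.
  exact: lerD.
rewrite /bnd expectD expect_riesz expectZ expectD !expectZ -/(mse _ _) mserho.
rewrite expect_riesz_sq lerD2l.
(* From [1 + y <= expR y], the product is at most the exponential of the sum of the [t i ^+ 2]. *)
have P : \prod_i (1 + eta i ^+ 2) <= rho^-1.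
  rewrite -[leRHS]lnK ?posrE ?invr_gt0 //.
  apply: (@le_trans _ _ (expR (\sum_i t i ^+ 2))); last by rewrite ler_expR.
  rewrite expR_sum; apply: ler_prod => i _; rewrite eta2 expR_ge1Dx.
  by rewrite addr_ge0 // sqr_ge0.
have : k * \prod_i (1 + eta i ^+ 2) <= k * rho^-1 by rewrite ler_pM2l.
have -> : k * rho^-1 = s by rewrite -s2 /k; field; rewrite gt_eqF.
have -> : k^-1 * rho ^+ 2 = s by rewrite -s2 /k; field; rewrite gt_eqF.
by lra.
Qed.

(* Soft thresholding at level [tau = 2 M / L]: testing with the weights
   [t i = min(|a i| / tau, 1)] forces [tau * sum t^2 <= M]. *)
Lemma affine_bounded_approx f rho a0 a :
  (forall x, -1 <= f x <= 1) -> 0 < rho -> rho < 1 ->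
  mse f (aff a0 a) = rho ^+ 2 ->
  exists2 h, affine_bounded h & mse f h <= 30 / ln rho^-1.
Proof.
move=> f1 rho0 rho1 mserho.
set L := ln rho^-1.
have L0 : 0 < L by rewrite ln_gt0 // invf_gt1.
have rhoL : rho <= L^-1.
  rewrite -[rho]invrK lef_pV2 ?posrE ?invr_gt0 //.
  by apply/ltW/ln_sublinear; rewrite invr_gt0.
set s := Num.sqrt rho.
have s0 : 0 < s by rewrite sqrtr_gt0.
have s2 : s ^+ 2 = rho by rewrite sqr_sqrtr // ltW.
have s1 : s <= 1 by rewrite -sqrtr1 ler_wsqrtr // ltW.
pose M := 1 + s; have M0 : 0 < M by rewrite /M; lra.
pose tau := 2 * M / L; have tau0 : 0 < tau by rewrite divr_gt0 ?mulr_gt0.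
have tauL : tau * L = 2 * M by rewrite divfK ?gt_eqF.
pose t i : R := if `|a i| <= tau then `|a i| / tau else 1.
pose b i : R := if `|a i| <= tau then 0 else (-1) ^+ (a i < 0)%R * (`|a i| - tau).
have t01 i : 0 <= t i <= 1.
  rewrite /t; case: ifP => [le|_]; last by rewrite ler01 lexx.
  by rewrite divr_ge0 ?(ltW tau0) //= ler_pdivrMr // mul1r.
(* Used twice: dropping [|b i|] bounds [tau * S], dropping the square bounds the sum of the
   [|b i|]. *)
have bt i : `|b i| + tau * t i ^+ 2 = `|a i| * t i.
  rewrite /b /t; case: ifP => [_|/negbT]; first by rewrite normr0; field; rewrite gt_eqF.
  rewrite -ltNge => lt; rewrite normrM normr_sign ger0_norm; first by ring.
  by rewrite subr_ge0 ltW.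
have abt i : (a i - b i) ^+ 2 = tau ^+ 2 * t i ^+ 2.
  rewrite /b /t; case: ifP => [_|_].
    rewrite subr0 -[LHS]real_normK ?num_real //.
    by field; rewrite gt_eqF.
  rewrite [X in X - _]numEsign mulrBr opprB addrCA subrr addr0.
  by rewrite exprMn sqrr_sign expr1n mul1r mulr1.
set S := \sum_i t i ^+ 2.
have S0 : 0 <= S by apply: sumr_ge0 => i _; rewrite sqr_ge0.
have tS : tau * S <= \sum_i `|a i| * t i.
  rewrite mulr_sumr; apply: ler_sum => i _.
  by rewrite -bt lerDr normr_ge0.
(* Otherwise the weights scaled by [L / S] are admissible, and the coefficient bound gives
   [tau * L <= M], contradicting [tau * L = 2 * M]. *)
have SL : S <= L.
  rewrite leNgt; apply/negP => LS.
  have Sp : 0 < S by apply: lt_trans LS.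
  have q0 : 0 < L / S by rewrite divr_gt0.
  have q1 : L / S <= 1 by rewrite ler_pdivrMr // mul1r ltW.
  have := @affine_coef_bound f a0 a rho (fun i => L / S * t i) f1 rho0 mserho.
  have -> : \sum_i (L / S * t i) ^+ 2 = L / S * L.
    under eq_bigr do rewrite exprMn.
    by rewrite -mulr_sumr -/S; field; rewrite gt_eqF.
  have -> : \sum_i `|a i| * (L / S * t i) = L / S * \sum_i `|a i| * t i.
    by rewrite mulr_sumr; apply: eq_bigr => i _; rewrite mulrCA.
  have H1 i : 0 <= L / S * t i <= 1.
    have /andP[? ?] := t01 i; rewrite mulr_ge0 ?(ltW q0) //=.
    by rewrite mulr_ile1 // ltW.
  have H2 : L / S * L <= L by rewrite ler_piMl // ltW.
  move=> /(_ H1 H2); rewrite -/s -/M.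
  have : L / S * (tau * S) <= L / S * \sum_i `|a i| * t i by rewrite ler_pM2l.
  have -> : L / S * (tau * S) = tau * L by field; rewrite gt_eqF.
  by have := normr_ge0 a0; rewrite tauL; lra.
have KM : `|a0| + \sum_i `|a i| * t i <= M.
  exact: affine_coef_bound f1 rho0 mserho t01 SL.
have bM : `|a0| + \sum_i `|b i| <= M.
  apply: le_trans KM; rewrite lerD2l; apply: ler_sum => i _.
  by rewrite -bt lerDl mulr_ge0 ?sqr_ge0 // ltW.
have gM x : `|aff a0 b x| <= M by apply: le_trans bM; apply: aff_norm_le.
have MV : M^-1 * M = 1 by rewrite mulVf ?gt_eqF.
exists (fun x => M^-1 * aff a0 b x).
  split=> [|x].
    exists (M^-1 * a0), (fun i => M^-1 * b i) => x.
    by rewrite mulrDr mulr_sumr; congr (_ + _); apply: eq_bigr => i _; rewrite mulrA.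
  rewrite -ler_norml normrM ger0_norm ?invr_ge0 ?(ltW M0) //.
  by rewrite -MV ler_pM2l ?invr_gt0.
(* The error splits into projection, thresholding and rescaling parts, the last at most [s] since
   [1 - 1/M = s/M]; the factor 3 is from [(p+q+w)^2 <= 3(p^2+q^2+w^2)]. *)
apply: (@le_trans _ _ (expect (fun x => 3 * ((f x - aff a0 a x) ^+ 2
    + aff 0 (fun i => a i - b i) x ^+ 2 + s ^+ 2)))).
  apply: le_expect => x.
  have := affB a0 a a0 b x; rewrite subrr => <-.
  set u := f x; set g := aff a0 a x; set v := aff a0 b x.
  have : (v - M^-1 * v) ^+ 2 <= s ^+ 2.
    rewrite -[leLHS]real_normK ?num_real // lerXn2r ?nnegrE ?(ltW s0) //.
    have -> : v - M^-1 * v = (M^-1 * s) * v.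
      by rewrite -{1}[v]mul1r -MV /M; ring.
    rewrite normrM ger0_norm ?mulr_ge0 ?invr_ge0 ?(ltW M0) ?(ltW s0) //.
    apply: (@le_trans _ _ (M^-1 * s * M)).
      by rewrite ler_pM2l ?mulr_gt0 ?invr_gt0 //; apply: gM.
    by rewrite mulrAC MV mul1r.
  set w := v - M^-1 * v; set p := u - g; set q := g - v => hw.
  have -> : u - M^-1 * v = p + q + w by rewrite /p /q /w; ring.
  have := sqr_ge0 (p - q); have := sqr_ge0 (p - w); have := sqr_ge0 (q - w).
  by nra.
rewrite expectZ !expectD expect_const -/(mse _ _) mserho expect_aff_sq s2.
have -> : \sum_i (a i - b i) ^+ 2 = tau * (tau * S).
  by rewrite !mulr_sumr; apply: eq_bigr => i _; rewrite abt; ring.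
(* The three parts contribute at most [1/L], [2 M^2 / L <= 8/L] and [1/L], whence [3 * 10 / L]. *)
have : tau * S <= M by have := normr_ge0 a0; lra.
rewrite -(ler_pM2l tau0) => H.
have : tau * M <= 8 * L^-1.
  rewrite /tau mulrAC ler_pM2r ?invr_gt0 //.
  have M2 : M <= 2 by rewrite /M; lra.
  by nra.
have : rho ^+ 2 <= rho by rewrite expr2 ger_pMl // ltW.
by rewrite expr0n /=; lra.
Qed.

End Expectation.

(* The bound is computed in the extended reals, where 0^-1 = +oo and
   +oo^-1 = 0: it is 0 when rho = 0 and +oo when rho = 1. *)
Theorem theorem3 (R : realType) (n : nat) (hn : (1 <= n)%N)
    (f : cube n -> R) (hf : forall x, -1 <= f x <= 1)
    (rho : R) (hrho : rho = distL2 f (@affine R n)) :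
  ((distL2 f (@affine_bounded R n))%:E
     <= 18%:E / sqrte (lne (1 / rho%:E)))%E.
Proof.
have [a0 [a dE]] := distL2_affine f; rewrite -hrho in dE.
have rho0 : 0 <= rho by rewrite dE sqrtr_ge0.
have mserho : mse f (aff a0 a) = rho ^+ 2 by rewrite dE sqr_sqrtr // mse_ge0.
have [rhoE|rhoN0] := eqVneq rho 0.
  (* At distance 0, [f] is itself affine with values in [-1,1]. *)
  have fE x : f x = aff a0 a x.
    apply/eqP; rewrite -subr_eq0 -sqrf_eq0; apply/eqP.
    move: x; apply: expect_eq0 => [x|]; first exact: sqr_ge0.
    by rewrite -/(mse _ _) mserho rhoE expr0n.
  rewrite rhoE inve0 mul1e /= invey mule0 lee_fin.
  have -> : 0 = Num.sqrt (mse f f).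
    rewrite /mse (@eq_expect _ _ _ (fun=> 0)) ?expect_const ?sqrtr0 //.
    by move=> x; rewrite subrr expr0n.
  by apply: distL2_le; split=> //; exists a0, a.
have rhop : 0 < rho by rewrite lt_neqAle eq_sym rhoN0.
have rho1 : rho <= 1.
  rewrite hrho; apply: (@le_trans _ _ (Num.sqrt (mse f (fun=> 0)))).
    apply: distL2_le; exists 0, (fun=> 0) => x.
    by rewrite big1 ?addr0 // => i _; rewrite mul0r.
  rewrite -sqrtr1 ler_wsqrtr // -(expect1 R n); apply: le_expect => x.
  by rewrite subr0; have /andP[? ?] := hf x; nra.
rewrite inver (negPf rhoN0) mul1e lne_EFin ?invr_gt0 //=.
move: rho1; rewrite le_eqVlt => /predU1P[->|rho1].
  by rewrite invr1 ln1 sqrtr0 inve0 gt0_muley ?lte_fin ?leey.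
have L0 : 0 < ln rho^-1 by rewrite ln_gt0 // invf_gt1.
rewrite inver gt_eqF ?sqrtr_gt0 // -EFinM lee_fin.
have [h hB hle] := affine_bounded_approx hf rhop rho1 mserho.
apply: (le_trans (distL2_le f hB)).
(* After squaring, it remains that [30 <= 18^2]. *)
rewrite -[leRHS]ger0_norm ?divr_ge0 ?sqrtr_ge0 // -sqrtr_sqr ler_wsqrtr //.
rewrite exprMn exprVn sqr_sqrtr ?(ltW L0) //; apply: (le_trans hle).
by rewrite ler_pM2r ?invr_gt0 //; lra.
Qed.
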